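(* Let $n\in\mathbb{N}$ and let $\mathcal{C}\subseteq\{0,1\}^n$ be an intersection-closed class, of VC dimension $d$. Then $\mathcal{C}$ has a (corner peeling) unlabelled compression scheme of size at most $11d$.
   Context: A concept class is a subset $\mathcal{C}\subseteq\{0,1\}^n$; $[n]=\{1,\dots,n\}$. For $I\subseteq[n]$, $\mathrm{proj}_I(v)=(v_i)_{i\in I}$ and $\mathrm{proj}_I(\mathcal{C})=\{\mathrm{proj}_I(v):v\in\mathcal{C}\}$. $\mathcal{C}$ shatters $I$ if $\mathrm{proj}_I(\mathcal{C})=\{0,1\}^{|I|}$, and the VC dimension of $\mathcal{C}$ is the maximum of $|I|$ over shattered $I$. For $v,w\in\{0,1\}^n$, $v\odot w=(v_1w_1,\dots,v_nw_n)$. $\mathcal{C}$ is intersection closed if $v\odot w\in\mathcal{C}$ whenever $v,w\in\mathcal{C}$. An unlabelled compression scheme (representation mapping) of size $k$, where $k<n$, of $\mathcal{C}$ is a map $r$ such that (1) $r$ is an injection from $\mathcal{C}$ to the subsets of $[n]$ of size at most $k$, and (2) (non-clashing) $\mathrm{proj}_{r(v)\cup r(v')}(v)\neq\mathrm{proj}_{r(v)\cup r(v')}(v')$ for all $v\neq v'$ in $\mathcal{C}$. Corner peeling: a cube with colour set $I\subseteq[n]$ is a set of all points of $\{0,1\}^n$ having prescribed values on $[n]\setminus I$, and a class $\mathcal{E}\subseteq\{0,1\}^n$ is extremal if whenever $\mathcal{E}$ shatters $I$, $\mathcal{E}$ contains a cube with colour set $I$. A corner peeling of an extremal class $\mathcal{E}$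 is an ordering $c_1,\dots,c_m$ of its elements such that each $\mathcal{E}_i=\{c_1,\dots,c_i\}$ is extremal; it yields the map sending $c_i$ to the set of coordinates in which $c_i$ differs from those elements of $\mathcal{E}_i$ at Hamming distance one from it. A scheme for $\mathcal{C}$ is a corner peeling scheme if it is the restriction to $\mathcal{C}$ of such a map for an extremal class $\mathcal{E}\supseteq\mathcal{C}$.
   Formalization: The requirement k < n on the size of a scheme is imposed only when d < n, since for the full cube {0,1}^n (where d = n, including n = 0) no injection into subsets of size at most k < n exists; there a scheme of size k ≤ 11d is still asserted. *)

(* Defs.v *)
From mathcomp Require Import all_boot.

Set Implicit Arguments.
Unset Strict Implicit.
Unset Printing Implicit Defensive.

Notation point n := {ffun 'I_n -> bool}.

Section Classes.
Variable n : nat.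
Implicit Types (C E : {set point n}) (I : {set 'I_n}) (v w : point n).

Definition proj I v : {ffun {i : 'I_n | i \in I} -> bool} :=
  [ffun i : {i : 'I_n | i \in I} => v (val i)].

Definition shatters C I : bool := [set proj I v | v in C] == setT.

(* The empty class shatters nothing, not even set0; its maximum is 0 here. *)
Definition VCdim C : nat := \max_(I : {set 'I_n} | shatters C I) #|I|.

Definition odot v w : point n := [ffun i => v i && w i].

Definition intersection_closed C : Prop :=
  forall v w, v \in C -> w \in C -> odot v w \in C.

(* The bound k < n is not part of this definition: no class equal to the whole
   of {0,1}^n has such an r with k < n, as there are only 2^n - 1 proper
   subsets of 'I_n. The bound is to be imposed separately. *)
Definition unlabelled_scheme C (k : nat) (r : point n -> {set 'I_n}) : Prop :=
  [/\ {in C &, injective r},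
      {in C, forall v, #|r v| <= k}
    & {in C &, forall v w, v != w ->
        proj (r v :|: r w) v != proj (r v :|: r w) w}].

(* The prescribed values, on the complement of I, are given by a. *)
Definition cube I (a : {ffun {i : 'I_n | i \in ~: I} -> bool}) : {set point n} :=
  [set v | proj (~: I) v == a].

Definition extremal E : Prop :=
  forall I, shatters E I -> exists a, @cube I a \subset E.

Definition hamming v w : nat := #|[set i | v i != w i]|.

(* In 0-based indexing, take i.+1 s lists the points up to and including the
   one at position i. *)
Definition corner_peeling E (s : seq (point n)) : Prop :=
  [/\ uniq s, s =i E
    & forall i, i < size s -> extremal [set x in take i.+1 s]].

Definition peeling_map (s : seq (point n)) v : {set 'I_n} :=
  [set j | [exists w in take (index v s).+1 s,
              (hamming v w == 1) && (v j != w j)]].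

Definition corner_peeling_map C (r : point n -> {set 'I_n}) : Prop :=
  exists (E : {set point n}) (s : seq (point n)),
    [/\ C \subset E, extremal E, corner_peeling E s
      & {in C, r =1 peeling_map s}].

End Classes.

(* Main.v *)
Require Import Defs.
From mathcomp Require Import all_boot.

(** Every concept [v] has a smallest set [X] of coordinates such that [v] is the
    least member of [C] containing [X]; minimality makes [C] shatter [X], so
    [#|X| <= VCdim C], and [v |-> X] is non-clashing.  The down-closure of [C]
    has a corner peeling inducing this map.  Treat the concepts [v] by
    increasing cardinality; before [v] the points listed form the down-closure
    of the concepts already treated.  List first, upwards, the new subsets of
    [v] that do not contain [X], and then, downwards from [v] itself, the
    interval from [X] to [v].  When [v] is listed, its neighbours present are
    exactly the [v :\ x] with [x] in [X]. *)

Set Implicit Arguments.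
Unset Strict Implicit.
Unset Printing Implicit Defensive.

(** * Points as sets: extremal families and the peeling set of an appended point *)

Section SetFamilies.
Variable n : nat.
Implicit Types (I A B V X : {set 'I_n}) (F P Q W : {set {set 'I_n}}).
Implicit Types (C : {set point n}) (v w : point n) (s : seq (point n)).

Definition supp v : {set 'I_n} := [set i | v i].
Definition indic A : point n := [ffun i => i \in A].
Definition class_of F : {set point n} := [set v | supp v \in F].

Lemma suppK : cancel supp indic.
Proof. by move=> v; apply/ffunP=> i; rewrite ffunE inE. Qed.

Lemma indicK : cancel indic supp.
Proof. by move=> A; apply/setP=> i; rewrite inE ffunE. Qed.

Lemma supp_odot v w : supp (odot v w) = supp v :&: supp w.
Proof. by apply/setP=> i; rewrite !inE ffunE. Qed.

Lemma shattersP C I :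
  reflect (forall A, A \subset I -> exists2 v, v \in C & supp v :&: I = A)
          (shatters C I).
Proof.
apply: (iffP eqP) => [shI A sAI | shI].
  pose f : {ffun {i : 'I_n | i \in I} -> bool} := [ffun i => val i \in A].
  have: f \in [set proj I v | v in C] by rewrite shI inE.
  case/imsetP=> v Cv fE; exists v => //.
  apply/setP=> i; rewrite !inE.
  case Ii: (i \in I); last by rewrite andbF; apply/esym/(contraFF _ Ii)/(subsetP sAI).
  by move/ffunP/(_ (exist _ i Ii)): fE; rewrite !ffunE /= andbT => ->.
apply/setP=> f; rewrite !inE.
have [|v Cv vE] := shI [set val i | i in [pred i | f i]].
  by apply/subsetP=> _ /imsetP[i _ ->]; apply: valP.
apply/imsetP; exists v => //; apply/ffunP=> i; rewrite ffunE.
move/setP/(_ (val i)): vE; rewrite mem_imset; last exact: val_inj.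
by rewrite !inE (valP i) andbT.
Qed.

Lemma extremal_class_of F :
    (forall I, (forall A, A \subset I -> exists2 B, B \in F & B :&: I = A) ->
       exists B, forall A, A \subset I -> A :|: (B :\: I) \in F) ->
  extremal (class_of F).
Proof.
move=> extF I /shattersP shI.
have [A sAI | B cubeB] := extF I.
  by have [v + vE] := shI A sAI; rewrite inE => Fv; exists (supp v).
exists (proj (~: I) (indic B)); apply/subsetP=> v; rewrite !inE => /eqP vB.
have := cubeB _ (subsetIr (supp v) I); congr (_ \in F).
apply/setP=> i; rewrite !inE; case Ii: (i \in I); first by rewrite andbT orbF.
have nIi : i \in ~: I by rewrite inE Ii.
by move/ffunP/(_ (exist _ i nIi)): vB; rewrite !ffunE /= andbF => ->.
Qed.

Definition hereditary F := forall A B, A \subset B -> B \in F -> A \in F.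

(** A shattered [I] lies inside a member of [F], so all subsets of [I] belong to [F]; they form the
    cube that is 0 outside [I]. *)
Lemma extremal_hereditary F : hereditary F -> extremal (class_of F).
Proof.
move=> hF; apply: extremal_class_of => I shI.
have [B FB BI] := shI I (subxx I); exists set0 => A sAI.
by rewrite set0D setU0 (hF _ B) // (subset_trans sAI) // -BI subsetIl.
Qed.

(** This covers the stages at which an interval is listed downwards. If [I] is shattered but not in
    [P], the member with trace [I] lies in [W], so [X \subset I] and [I \subset V]; the cube is then
    the one agreeing with [V] outside [I]. *)
Lemma extremal_hereditary_interval P W X V :
    hereditary P -> X \notin P ->
    (forall A, A \subset V -> ~~ (X \subset A) -> A \in P) ->
    (forall A, A \in W -> X \subset A /\ A \subset V) ->
    (forall A B, A \in W -> A \subset B -> B \subset V -> B \in W) ->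
  extremal (class_of (P :|: W)).
Proof.
move=> hP XnP belowP W_XV upW; apply: extremal_class_of => I shI.
case PI: (I \in P).
  exists set0 => A sAI.
  by rewrite set0D setU0 inE (hP _ I).
have [B + BI] := shI I (subxx I).
have sIB : I \subset B by rewrite -BI subsetIl.
rewrite inE => /orP[PB | WB]; first by rewrite (hP _ B) in PI.
have [_ sBV] := W_XV _ WB; have sIV := subset_trans sIB sBV.
have sXI : X \subset I by apply: contraFT PI; apply: belowP.
have [B' + B'I] := shI X sXI.
have sXB' : X \subset B' by rewrite -B'I subsetIl.
rewrite inE => /orP[PB' | WB']; first by rewrite (hP _ B') in XnP.
have [_ sB'V] := W_XV _ WB'; exists V => A sAI.
have sAV : A :|: (V :\: I) \subset V.
  by rewrite subUset subsetDl (subset_trans sAI).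
(* Members of the cube that miss part of [X] are in [P]. The others contain [B'], since
   [B' :&: I = X] and [B' \subset V], and so lie in the up-closed [W]. *)
case: (boolP (X \subset A :|: (V :\: I))) => [sXA | /(belowP _ sAV) PA].
  rewrite inE (upW B') ?orbT //; apply/subsetP=> i B'i; rewrite !inE.
  case Ii: (i \in I) => /=; last by rewrite (subsetP sB'V) ?orbT.
  have: i \in X by rewrite -B'I inE B'i.
  by move/(subsetP sXA); rewrite !inE Ii.
by rewrite inE PA.
Qed.

Lemma peeling_map_rcons s v w :
  w \in s -> peeling_map (rcons s v) w = peeling_map s w.
Proof.
move=> sw; have lt_w : index w s < size s by rewrite index_mem.
by rewrite /peeling_map -cats1 index_cat sw takel_cat.
Qed.

(** A listed neighbour agreeing with [v] on [X] would contain [X] and force [X \in Q]. So every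
    listed neighbour drops one element of [X], and the last hypothesis says that all of these are
    listed. *)
Lemma peeling_map_last s v Q X :
    v \notin s -> s =i class_of Q -> hereditary Q ->
    X \subset supp v -> X \notin Q ->
    (forall j, j \in X -> supp v :\ j \in Q) ->
  peeling_map (rcons s v) v = X.
Proof.
move=> sNv sE hQ sXv XnQ Qv.
have takeE : take (index v (rcons s v)).+1 (rcons s v) = rcons s v.
  by rewrite -cats1 index_cat (negPf sNv) /= eqxx addn0 take_oversize // size_cat addn1.
apply/setP=> j; rewrite /peeling_map inE takeE.
apply/existsP/idP => [[w /and3P[]] | Xj].
  rewrite mem_rcons inE => /orP[/eqP-> | sw]; first by rewrite eqxx.
  case/cards1P=> k dE vwj; have : j \in [set i | v i != w i] by rewrite inE.
  rewrite dE inE => /eqP jk; apply: contraNT XnQ => Xnj.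
  move: sw; rewrite sE inE; apply: hQ; apply/subsetP=> i Xi.
  have := subsetP sXv i Xi; rewrite !inE => vi.
  have: i \notin [set i | v i != w i].
    by rewrite dE inE -jk; apply: contraNneq Xnj => <-.
  by rewrite inE negbK vi => /eqP<-.
have vj : v j by have := subsetP sXv j Xj; rewrite inE.
exists (indic (supp v :\ j)); rewrite mem_rcons inE sE inE indicK Qv // orbT /=.
rewrite ffunE !inE eqxx vj /= andbT; apply/cards1P; exists j.
apply/setP=> i; rewrite !inE ffunE !inE.
by have [-> | _] := eqVneq i j; rewrite ?vj ?eqxx.
Qed.

End SetFamilies.

(** * Minimal spanning sets and the compression scheme *)

Section IntersectionClosed.
Variables (n : nat) (C : {set point n}).
Hypothesis hC : intersection_closed C.
Implicit Types (A B V X : {set 'I_n}) (F P Q W : {set {set 'I_n}}).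
Implicit Types (u v w : point n) (D : {set point n}) (s : seq (point n)).

Definition spans X v :=
  (X \subset supp v) &&
  [forall u in C, (X \subset supp u) ==> (supp v \subset supp u)].

Definition basis v : {set 'I_n} := [arg min_(X < supp v | spans X v) #|X|].

Lemma spansP X v :
  reflect (X \subset supp v /\
           forall u, u \in C -> X \subset supp u -> supp v \subset supp u)
          (spans X v).
Proof.
apply: (iffP andP) => [[sXv /forall_inP h] | [sXv h]]; split=> //.
  by move=> u Cu; apply/implyP/h.
by apply/forall_inP=> u Cu; apply/implyP/h.
Qed.

Lemma spans_supp v : spans (supp v) v.
Proof. exact/spansP. Qed.

Lemma basis_spans v : spans (basis v) v.
Proof. by rewrite /basis; case: arg_minnP => //; apply: spans_supp. Qed.

Lemma basis_sub v : basis v \subset supp v.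
Proof. by case/spansP: (basis_spans v). Qed.

Lemma basis_least v u : u \in C -> basis v \subset supp u -> supp v \subset supp u.
Proof. by case/spansP: (basis_spans v) => _; apply. Qed.

(** By minimality [basis v :\ x] does not span [v], so some concept contains it but not [supp v].
    That concept omits [x], or it would contain [basis v] and hence [supp v]. *)
Lemma basis_avoid v x : x \in basis v ->
  exists2 u, u \in C & (basis v :\ x \subset supp u) && (x \notin supp u).
Proof.
move=> bx.
have: ~~ spans (basis v :\ x) v.
  apply/negP=> sp; have: #|basis v| <= #|basis v :\ x|.
    rewrite {1}/basis; case: arg_minnP => [|X _]; first exact: spans_supp.
    exact.
  by rewrite [leqLHS](cardsD1 x) bx ltnn.
rewrite /spans (subset_trans (subsetDl _ _) (basis_sub v)) /=.
case/forall_inPn=> u Cu; rewrite negb_imply => /andP[sbu vNu].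
exists u => //; rewrite sbu; apply: contraNN vNu => ux.
by apply: basis_least; rewrite // -(setD1K bx) subUset sub1set ux.
Qed.

(** Intersecting [v] with the concepts that [basis_avoid] gives for the [x] in [B] deletes exactly
    [B] from the trace on [basis v]. *)
Lemma basis_shattered v : v \in C -> shatters C (basis v).
Proof.
move=> Cv.
have shD m B : #|B| = m -> B \subset basis v ->
    exists2 u, u \in C & supp u :&: basis v = basis v :\: B.
  elim: m B => [|m IHm] B cardB sBb.
    exists v => //; rewrite (cards0_eq cardB) setD0.
    exact/setIidPr/basis_sub.
  have /set0Pn[x Bx] : B != set0 by rewrite -card_gt0 cardB.
  have [||u Cu uE] := IHm (B :\ x).
  - by apply/eqP; rewrite -eqSS -cardB [#|B|](cardsD1 x) Bx.
  - exact: subset_trans (subsetDl _ _) sBb.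
  have [u' Cu' /andP[su' xNu']] := basis_avoid (subsetP sBb x Bx).
  exists (odot u u'); first exact: hC.
  rewrite supp_odot setIAC uE; apply/setP=> i; rewrite !inE.
  have [-> | neq_ix] := eqVneq i x.
    by move: xNu'; rewrite inE => /negPf->; rewrite Bx andbF.
  case bi: (i \in basis v); rewrite ?andbF //= !andbT.
  by have := subsetP su' i; rewrite !inE neq_ix bi => ->; rewrite ?andbT.
apply/shattersP=> A sAb.
have [u Cu uE] := shD _ (basis v :\: A) erefl (subsetDl _ _).
by exists u => //; rewrite uE setDDr setDv set0U; apply/setIidPr.
Qed.

Lemma basis_card v : v \in C -> #|basis v| <= VCdim C.
Proof. by move=> Cv; apply/leq_bigmax_cond/basis_shattered. Qed.

(** Two concepts that agree on the union of their bases each contain the basis of the other, hence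
    each other. Equal bases lead to the same situation. *)
Lemma basis_scheme : unlabelled_scheme C (VCdim C) basis.
Proof.
have eq_agree v w : v \in C -> w \in C ->
    basis v \subset supp w -> basis w \subset supp v -> v = w.
  move=> Cv Cw svw swv; apply: (can_inj (@suppK n)); apply/eqP.
  by rewrite eqEsubset !basis_least.
split=> [v w Cv Cw bvw | | v w Cv Cw].
- by apply: eq_agree => //; [rewrite bvw | rewrite -bvw]; apply: basis_sub.
- exact: basis_card.
apply: contraNneq => /ffunP agree.
have vw i : i \in basis v :|: basis w -> v i = w i.
  by move=> Ui; have := agree (exist _ i Ui); rewrite !ffunE.
apply/eqP; apply: eq_agree => //; apply/subsetP=> i bi; rewrite inE.
  by rewrite -vw ?inE ?bi //; have := subsetP (basis_sub v) i bi; rewrite inE.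
by rewrite vw ?inE ?bi ?orbT //; have := subsetP (basis_sub w) i bi; rewrite inE.
Qed.

(** * Growing a corner peeling of the down-closure *)

Definition peelable F := exists s,
  [/\ uniq s, s =i class_of F,
      forall i, i < size s -> extremal [set x in take i.+1 s]
    & forall v, v \in C -> v \in s -> peeling_map s v = basis v].

Lemma peelable0 : peelable set0.
Proof. by exists [::]; split=> // v; rewrite !inE. Qed.

(** Appending a point changes neither the earlier prefixes nor their peeling sets, so only the
    enlarged family and the new point need checking. *)
Lemma peelable_add F A :
    peelable F -> A \notin F -> extremal (class_of (A |: F)) ->
    (forall s, s =i class_of F -> indic A \in C ->
       peeling_map (rcons s (indic A)) (indic A) = basis (indic A)) ->
  peelable (A |: F).
Proof.
move=> [s [uniq_s sE ext_s bas_s]] FNA extA basA.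
have sNA : indic A \notin s by rewrite sE inE indicK.
have rE : rcons s (indic A) =i class_of (A |: F).
  move=> v; rewrite mem_rcons !inE sE inE -{1}[v]suppK.
  by rewrite (inj_eq (can_inj (@indicK n))).
exists (rcons s (indic A)); split=> // [|i|v Cv].
- by rewrite rcons_uniq sNA.
- rewrite size_rcons ltnS leq_eqVlt => /orP[/eqP-> | lt_i].
    rewrite take_oversize ?size_rcons //.
    suff -> : [set x in rcons s (indic A)] = class_of (A |: F) by [].
    by apply/setP=> v; rewrite inE rE.
  by rewrite -cats1 takel_cat //; apply: ext_s.
rewrite mem_rcons inE => /orP[/eqP vE | sv]; last by rewrite peeling_map_rcons ?bas_s.
by rewrite vE basA // -vE.
Qed.

(** Adding a smallest missing set keeps the family hereditary, hence extremal. No added set is a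
    concept, so no basis has to be matched. *)
Lemma peelable_hereditary P Q :
    peelable P -> hereditary P -> hereditary Q -> P \subset Q ->
    (forall A, A \in Q -> indic A \in C -> A \in P) ->
  peelable Q.
Proof.
move: {2}#|Q :\: P| (erefl #|Q :\: P|) => m; elim: m P => [|m IHm] P cardD pP hP hQ sPQ CP.
  suff -> : Q = P by [].
  by apply/eqP; rewrite eqEsubset sPQ andbT -setD_eq0 -cards_eq0 cardD.
have /set0Pn[A0 D0] : Q :\: P != set0 by rewrite -card_gt0 cardD.
have [A] := arg_minnP (fun A => #|A|) D0 => /setDP[QA PNA] minA.
have hAP : hereditary (A |: P).
  move=> B B' sBB'; rewrite !inE => /predU1P[B'A | PB']; last by rewrite (hP _ B') ?orbT.
  rewrite {}B'A in sBB'; case: (boolP (B \in P)) => [|PNB]; rewrite ?orbT //.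
  by rewrite orbF eqEcard sBB'; apply: minA; apply/setDP; rewrite (hQ _ A).
apply: (IHm (A |: P)) => //.
- apply/eqP; rewrite -eqSS -cardD (cardsD1 A (Q :\: P)) inE PNA QA add1n eqSS.
  by apply/eqP; congr #|pred_of_set _|; apply/setP=> B; rewrite !inE negb_or andbA.
- apply: peelable_add => // [|s _ CA]; first exact: extremal_hereditary.
  by rewrite CP in PNA.
- by rewrite subUset sub1set QA.
by move=> B QB CB; rewrite inE CP ?orbT.
Qed.

(** Induction on [#|W|]: a smallest member is listed last, and removing it leaves [W] closed upwards
    inside [supp v]. *)
Lemma peelable_interval v P W :
    v \in C -> peelable P -> hereditary P -> basis v \notin P ->
    (forall A, A \subset supp v -> ~~ (basis v \subset A) -> A \in P) ->
    (forall A, A \in W -> basis v \subset A /\ A \subset supp v) ->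
    (forall A B, A \in W -> A \subset B -> B \subset supp v -> B \in W) ->
  peelable (P :|: W).
Proof.
move=> Cv pP hP bNP belowP; move: {2}#|W| (erefl #|W|) => m.
elim: m W => [|m IHm] W cardW W_bv upW; first by rewrite (cards0_eq cardW) setU0.
have /set0Pn[A0 W0] : W != set0 by rewrite -card_gt0 cardW.
have [A WA minA] := arg_minnP (fun A => #|A|) W0.
have {}WA : A \in W := WA.
have [sbA sAv] := W_bv A WA.
have WE : P :|: W = A |: (P :|: (W :\ A)) by rewrite setUCA setD1K.
rewrite WE; apply: peelable_add.
- apply: IHm => [|B|B B'].
  + by apply/eqP; rewrite -eqSS -cardW (cardsD1 A W) WA.
  + by case/setD1P=> _; apply: W_bv.
  rewrite !inE => /andP[BA WB] sBB' sB'v; rewrite (upW B) // andbT.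
  apply: contraNneq BA => B'A; rewrite {}B'A in sBB'.
  by rewrite eqEcard sBB'; apply: minA.
- by rewrite !inE eqxx orbF; apply: contra bNP; apply: hP.
- by rewrite -WE; apply: (extremal_hereditary_interval hP bNP belowP).
(* A concept containing [basis v] contains [supp v], so the only concept in the interval is [v]. If
   it is smallest in [W], it is all of [W], and exactly [P] precedes it. *)
move=> s sE CA; have AE : A = supp v.
  by apply/eqP; rewrite eqEsubset sAv -[A]indicK basis_least // indicK.
have W0A : W :\ A = set0.
  apply/eqP; rewrite -subset0; apply/subsetP=> B /setD1P[/eqP neqBA WB].
  by case: neqBA; apply/eqP; rewrite eqEcard minA // AE andbT; case: (W_bv _ WB).
rewrite W0A setU0 in sE; rewrite AE suppK.
apply: (peeling_map_last _ sE) => //; rewrite ?basis_sub //.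
  by rewrite sE inE; apply: contra bNP; apply: hP; apply: basis_sub.
move=> j bj; apply: belowP; first exact: subsetDl.
by apply/subsetPn; exists j; rewrite // !inE eqxx.
Qed.

Definition down D : {set {set 'I_n}} := [set A : {set 'I_n} | [exists v in D, A \subset supp v]].

Lemma downP D A : reflect (exists2 v, v \in D & A \subset supp v) (A \in down D).
Proof. by rewrite inE; apply: exists_inP. Qed.

Lemma hereditary_down D : hereditary (down D).
Proof.
move=> A B sAB /downP[v Dv sBv]; apply/downP; exists v => //.
exact: subset_trans sAB sBv.
Qed.

(** Induction by removing a largest concept [v] of [D]: a concept containing [basis v] contains
    [supp v], so [basis v] is outside the down-closure of the rest. *)
Lemma peelable_down D :
    D \subset C ->
    (forall u v, u \in C -> v \in D -> supp u \subset supp v -> u \in D) ->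
  peelable (down D).
Proof.
move: {2}#|D| (erefl #|D|) => m; elim: m D => [|m IHm] D cardD sDC idD.
  suff -> : down D = set0 by apply: peelable0.
  apply/eqP; rewrite -subset0; apply/subsetP=> A /downP[v].
  by rewrite (cards0_eq cardD) inE.
have /set0Pn[v0 D0] : D != set0 by rewrite -card_gt0 cardD.
have [v Dv maxv] := arg_maxnP (fun v => #|supp v|) D0.
have {}Dv : v \in D := Dv.
have Cv := subsetP sDC v Dv.
have top u : u \in D -> supp v \subset supp u -> u = v.
  move=> Du svu; apply: (can_inj (@suppK n)); apply/esym/eqP.
  by rewrite eqEcard svu; apply: maxv.
pose D' := D :\ v.
have bND' : basis v \notin down D'.
  apply/downP=> -[u /setD1P[neq_uv Du]] /(basis_least (subsetP sDC u Du)) svu.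
  by rewrite (top u) ?eqxx in neq_uv.
have pD' : peelable (down D').
  apply: IHm => [||u w Cu /setD1P[neq_wv Dw] suw].
  - by apply/eqP; rewrite -eqSS -cardD (cardsD1 v D) Dv.
  - exact: subset_trans (subsetDl _ _) sDC.
  rewrite !inE (idD u w) // andbT; apply: contraNneq neq_wv => uv.
  by rewrite (top w) // -uv.
pose Q := down D' :|:
  [set A : {set 'I_n} | (A \subset supp v) && ~~ (basis v \subset A)].
have hQ : hereditary Q.
  move=> A B sAB; rewrite !in_setU => /orP[DB | ].
    by rewrite (hereditary_down sAB DB).
  rewrite !in_set => /andP[sBv bNB]; apply/orP; right.
  by rewrite (subset_trans sAB sBv); apply: contra bNB => /subset_trans->.
have -> : down D =
    Q :|: [set A : {set 'I_n} | (basis v \subset A) && (A \subset supp v)].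
  apply/setP=> A; apply/downP/idP => [[u Du sAu] | ].
    have [uv | neq_uv] := eqVneq u v.
      by rewrite uv in sAu; rewrite !in_setU !in_set sAu /= andbT -orbA orNb orbT.
    by rewrite !in_setU (_ : A \in down D') //; apply/downP; exists u; rewrite // !inE neq_uv.
  rewrite !in_setU -orbA => /orP[/downP[u /setD1P[_ Du] sAu] | ]; first by exists u.
  by rewrite !in_set => sA; exists v => //; case/orP: sA => /andP[].
apply: (peelable_interval Cv).
- apply: (peelable_hereditary pD') => //; first exact: hereditary_down.
    exact: subsetUl.
  (* A concept among the sets just added lies below [v], so it is in [D]; it misses part of
     [basis v], so it is not [v] and was already in [down D']. *)
  move=> A; rewrite in_setU => /orP[// | ]; rewrite in_set => /andP[sAv bNA] CA.
  apply/downP; exists (indic A); rewrite ?indicK //.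
  rewrite !inE (idD _ v) ?indicK // andbT; apply: contraNneq bNA => Av.
  by rewrite -[A]indicK Av basis_sub.
- exact: hQ.
- by rewrite in_setU negb_or bND' in_set basis_sub subxx.
- by move=> A sAv bNA; rewrite in_setU !in_set sAv bNA orbT.
- by move=> A; rewrite in_set => /andP.
move=> A B; rewrite !in_set => /andP[sbA _] sAB ->.
by rewrite (subset_trans sbA).
Qed.

Lemma basis_corner_peeling : corner_peeling_map C basis.
Proof.
have [//|s [uniq_s sE ext_s bas_s]] := peelable_down (subxx C).
have sCE : C \subset class_of (down C).
  by apply/subsetP=> v Cv; rewrite inE; apply/downP; exists v.
exists (class_of (down C)), s; split=> //.
  exact/extremal_hereditary/hereditary_down.
by move=> v Cv; rewrite bas_s // sE (subsetP sCE).
Qed.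

End IntersectionClosed.

Theorem corollary4p7 (n : nat) (C : {set point n}) (d : nat)
    (hC : intersection_closed C) (hd : VCdim C = d) :
  exists (k : nat) (r : point n -> {set 'I_n}),
    [/\ k <= 11 * d, d < n -> k < n,
        unlabelled_scheme C k r & corner_peeling_map C r].
Proof.
(* The scheme has size [d] itself, which makes both numerical bounds immediate. *)
subst d; exists (VCdim C), (@basis n C); split; rewrite ?leq_pmull //.
  exact: basis_scheme.
exact: basis_corner_peeling.
Qed.
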